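(* In linear dependent type theory with the modalities $L$ and $M$ (rules recalled in the context), for every cartesian context $\Gamma$, cartesian type $\Gamma \vdash A \ \mathsf{type}$ and linear type $\Gamma \vdash B \ \mathsf{linear}$, there is a term $\Gamma; \beta_1 : (B_M)_L \vdash \epsilon_B : B$ with the following property: for any term $\Gamma; y : A_L \vdash f : B$ there is a unique term $\Gamma, x : A \vdash g : B_M$ such that \[\Gamma; y : A_L \vdash \epsilon_B[\text{let } x \text{ be } y \text{ in } g_L/\beta_1] \equiv f : B.\]
   Context: Linear dependent type theory has judgments $\vdash \Gamma;\Xi\ \mathsf{ctxt}$, $\Gamma \vdash A\ \mathsf{type}$ (cartesian type), $\Gamma \vdash B\ \mathsf{linear}$ (linear type), $\Gamma \vdash a : A$ (cartesian term), $\Gamma;\Xi \vdash b : B$ (linear term), together with judgmental equality $\equiv$. Here $\Gamma$ is a context of cartesian assumptions (weakening, contraction and exchange admissible) and $\Xi$ a context of linear assumptions (only exchange admissible); both cartesian and linear types may depend only on cartesian variables; $\cdot$ is the empty linear context. The modalities are given by the rules: (L-F) from $\Gamma\vdash A\ \mathsf{type}$ infer $\Gamma\vdash A_L\ \mathsf{linear}$; (L-I) from $\Gamma\vdash a:A$ infer $\Gamma;\cdot\vdash a_L:A_L$; (L-E) from $\Gamma\vdash B\ \mathsf{linear}$, $\vdash\Gamma;\Xi'\ \mathsf{ctxt}$, $\Gamma;\Xi\vdash y:A_L$ and $\Gamma,x:A;\Xi'\vdash t:B$ infer $\Gamma;\Xi,\Xi'\vdash \text{let } x \text{ be } y \text{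 in } t : B$; (L-C) $\text{let } x \text{ be } s_L \text{ in } t \equiv t[s/x]$ whenever the left side is well typed; (L-U) from $\Gamma; y:A_L,\Xi\vdash t:B$ and $\Gamma;\Xi'\vdash a:A_L$ infer $\Gamma;\Xi,\Xi'\vdash \text{let } x \text{ be } a \text{ in } t[x_L/y]\equiv t[a/y]:B$; (M-F) from $\Gamma\vdash B\ \mathsf{linear}$ infer $\Gamma\vdash B_M\ \mathsf{type}$; (M-I) from $\Gamma;\cdot\vdash b:B$ infer $\Gamma\vdash\sigma(b):B_M$; (M-E) from $\Gamma\vdash t:B_M$ infer $\Gamma;\cdot\vdash\sigma^{-1}(t):B$; (M-C$_1$) $\sigma^{-1}(\sigma(b))\equiv b$; (M-C$_2$) $\sigma(\sigma^{-1}(t))\equiv t$. *)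

(* Defs.v *)
From Stdlib Require Import List Permutation Arith.
Import ListNotations.

Set Implicit Arguments.
Unset Strict Implicit.

(* Raw syntax.  Cartesian variables are de Bruijn indices.  Free linear
   variables are names; linear variables bound by [labs] are de Bruijn indices
   [lbnd] (locally nameless).

   [cst], [ap], [cabs] and [labs] carry whatever other type and term formers
   the theory has besides the modalities: [O] is the set of their names, and a
   former with binders is encoded as a constant applied to abstractions, for
   instance Pi_(x:A) B as [ap (ap (cst pi) A) (cabs B)].  Base types and
   constants are elements of [O] as well. *)
Definition name := nat.

Inductive expr (O : Type) : Type :=
| cvar (n : nat)
| lvar (y : name)
| lbnd (n : nat)
| tyL (A : expr O)
| tmL (a : expr O)
| letL (y t : expr O)           (* let x be y in t, with x index 0 in t *)
| tyM (B : expr O)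
| sigma (b : expr O)
| sigma_inv (t : expr O)
| cst (o : O)
| ap (e1 e2 : expr O)
| cabs (e : expr O)
| labs (e : expr O).

Arguments cvar {O} n.
Arguments lvar {O} y.
Arguments lbnd {O} n.

Definition scons {X : Type} (x : X) (s : nat -> X) (n : nat) : X :=
  match n with 0 => x | S m => s m end.

Definition upr (r : nat -> nat) : nat -> nat := scons 0 (fun n => S (r n)).

Fixpoint ren (O : Type) (r : nat -> nat) (e : expr O) : expr O :=
  match e with
  | cvar n => cvar (r n)
  | lvar y => lvar y
  | lbnd n => lbnd n
  | tyL A => tyL (ren r A)
  | tmL a => tmL (ren r a)
  | letL y t => letL (ren r y) (ren (upr r) t)
  | tyM B => tyM (ren r B)
  | sigma b => sigma (ren r b)
  | sigma_inv t => sigma_inv (ren r t)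
  | cst o => cst o
  | ap e1 e2 => ap (ren r e1) (ren r e2)
  | cabs e => cabs (ren (upr r) e)
  | labs e => labs (ren r e)
  end.

Definition shift (O : Type) (e : expr O) : expr O := ren S e.

Definition up (O : Type) (s : nat -> expr O) : nat -> expr O :=
  scons (cvar 0) (fun n => shift (s n)).

(* Simultaneous substitution of both kinds of variables.  No adjustment is
   needed under [labs], the substituted expressions having no dangling
   [lbnd]. *)
Fixpoint sub (O : Type) (s : nat -> expr O) (l : name -> expr O) (e : expr O)
  : expr O :=
  match e with
  | cvar n => s n
  | lvar y => l y
  | lbnd n => lbnd n
  | tyL A => tyL (sub s l A)
  | tmL a => tmL (sub s l a)
  | letL y t => letL (sub s l y) (sub (up s) (fun z => shift (l z)) t)
  | tyM B => tyM (sub s l B)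
  | sigma b => sigma (sub s l b)
  | sigma_inv t => sigma_inv (sub s l t)
  | cst o => cst o
  | ap e1 e2 => ap (sub s l e1) (sub s l e2)
  | cabs e => cabs (sub (up s) (fun z => shift (l z)) e)
  | labs e => labs (sub s l e)
  end.

(* e[a/y] for a linear variable y. *)
Definition lsub (O : Type) (y : name) (a e : expr O) : expr O :=
  sub cvar (fun z => if Nat.eqb z y then a else lvar z) e.

(* e[a/x] for the cartesian variable x lying below k more recent ones. *)
Definition csub_at (O : Type) (a : expr O) (k : nat) (e : expr O) : expr O :=
  sub (Nat.iter k (@up O) (scons a cvar)) lvar e.

Definition csub (O : Type) (a e : expr O) : expr O := csub_at a 0 e.

(* Inserts a fresh cartesian variable below the k most recent ones. *)
Definition weaken_at (O : Type) (k : nat) (e : expr O) : expr O :=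
  ren (Nat.iter k upr S) e.

(* The head of a cartesian context is its most recent variable, so that
   "Gamma, x:A, Delta" is [Delta ++ A :: Gamma]. *)
Definition cctx (O : Type) := list (expr O).
Definition lctx (O : Type) := list (name * expr O).

Definition lctx_map (O : Type) (f : expr O -> expr O) (X : lctx O) : lctx O :=
  map (fun p => (fst p, f (snd p))) X.

(* Implicit whenever linear contexts are juxtaposed. *)
Definition distinct (O : Type) (X : lctx O) : Prop := NoDup (map fst X).

(* Applies F to a telescope; an entry with k entries below it is mapped by
   [F k]. *)
Fixpoint tele_map (O : Type) (F : nat -> expr O -> expr O) (D : cctx O)
  : cctx O :=
  match D with
  | [] => []
  | C :: D' => F (length D') C :: tele_map F D'
  end.

(* Judgments without their cartesian context: [HasLinear X b B] over G is
   "G; X |- b : B". *)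
Inductive body (O : Type) : Type :=
| IsCtx (X : lctx O)
| IsType (A : expr O)
| IsLinear (B : expr O)
| HasType (a A : expr O)
| HasLinear (X : lctx O) (b B : expr O)
| EqType (A A' : expr O)
| EqLinear (B B' : expr O)
| EqTerm (a a' A : expr O)
| EqLTerm (X : lctx O) (b b' B : expr O).

Arguments IsCtx {O} X.

Definition body_map (O : Type) (f : expr O -> expr O) (J : body O) : body O :=
  match J with
  | IsCtx X => IsCtx (lctx_map f X)
  | IsType A => IsType (f A)
  | IsLinear B => IsLinear (f B)
  | HasType a A => HasType (f a) (f A)
  | HasLinear X b B => HasLinear (lctx_map f X) (f b) (f B)
  | EqType A A' => EqType (f A) (f A')
  | EqLinear B B' => EqLinear (f B) (f B')
  | EqTerm a a' A => EqTerm (f a) (f a') (f A)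
  | EqLTerm X b b' B => EqLTerm (lctx_map f X) (f b) (f b') (f B)
  end.

Definition judgment (O : Type) : Type := (cctx O * body O)%type.

(* [scoped k m N e]: e has free cartesian indices below k, dangling [lbnd]
   indices below m, and free linear variables in N. *)
Fixpoint scoped (O : Type) (k m : nat) (N : list name) (e : expr O) : Prop :=
  match e with
  | cvar n => n < k
  | lvar y => In y N
  | lbnd n => n < m
  | tyL A => scoped k m N A
  | tmL a => scoped k m N a
  | letL y t => scoped k m N y /\ scoped (S k) m N t
  | tyM B => scoped k m N B
  | sigma b => scoped k m N b
  | sigma_inv t => scoped k m N t
  | cst _ => True
  | ap e1 e2 => scoped k m N e1 /\ scoped k m N e2
  | cabs e => scoped (S k) m N e
  | labs e => scoped k (S m) N e
  end.

Fixpoint scoped_cctx (O : Type) (G : cctx O) : Prop :=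
  match G with
  | [] => True
  | A :: G' => scoped (length G') 0 [] A /\ scoped_cctx G'
  end.

Definition scoped_lctx (O : Type) (k : nat) (X : lctx O) : Prop :=
  Forall (fun p => scoped k 0 [] (snd p)) X.

Definition scoped_judgment (O : Type) (G : cctx O) (J : body O) : Prop :=
  let k := length G in
  let c := scoped k 0 [] in
  let l X := scoped k 0 (map fst X) in
  scoped_cctx G /\
  match J with
  | IsCtx X => scoped_lctx k X
  | IsType A => c A
  | IsLinear B => c B
  | HasType a A => c a /\ c A
  | HasLinear X b B => scoped_lctx k X /\ l X b /\ c B
  | EqType A A' => c A /\ c A'
  | EqLinear B B' => c B /\ c B'
  | EqTerm a a' A => c a /\ c a' /\ c A
  | EqLTerm X b b' B => scoped_lctx k X /\ l X b /\ l X b' /\ c B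
  end.

(* Instances (premises, conclusion) of the rules governing the formers in O. *)
Definition ruleset (O : Type) := list (judgment O) -> judgment O -> Prop.

Reserved Notation "G ⊢ J" (at level 70, no associativity).

(* Linear dependent type theory with L and M, over arbitrary further formers O
   with rules R.  Weakening and substitution are taken as rules, since their
   admissibility would depend on R; contraction and exchange for cartesian
   variables, and renaming of linear variables, follow from them. *)
Inductive derivable (O : Type) (R : ruleset O) : cctx O -> body O -> Prop :=
| ctx_nil :
    [] ⊢ IsCtx []
| ctx_cext G X A :
    G ⊢ IsCtx X -> G ⊢ IsType A ->
    A :: G ⊢ IsCtx (lctx_map (@shift O) X)
| ctx_lext G X y B :
    G ⊢ IsCtx X -> G ⊢ IsLinear B -> ~ In y (map fst X) ->
    G ⊢ IsCtx (X ++ [(y, B)])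
| var_c G n A :
    G ⊢ IsCtx [] -> nth_error G n = Some A ->
    G ⊢ HasType (cvar n) (ren (fun i => S n + i) A)
| var_l G y B :
    G ⊢ IsCtx [(y, B)] ->
    G ⊢ HasLinear [(y, B)] (lvar y) B

| weakening G D A J :
    D ++ G ⊢ J -> G ⊢ IsType A ->
    tele_map (@weaken_at O) D ++ A :: G ⊢ body_map (weaken_at (length D)) J
| substitution G D A a J :
    D ++ A :: G ⊢ J -> G ⊢ HasType a A ->
    tele_map (csub_at a) D ++ G ⊢ body_map (csub_at a (length D)) J
| lin_substitution G X1 X2 X' y A a t B :
    G ⊢ HasLinear (X1 ++ (y, A) :: X2) t B ->
    G ⊢ HasLinear X' a A ->
    distinct (X1 ++ X' ++ X2) ->
    G ⊢ HasLinear (X1 ++ X' ++ X2) (lsub y a t) B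
| lin_exchange_ctx G X X' :
    G ⊢ IsCtx X -> Permutation X X' -> G ⊢ IsCtx X'
| lin_exchange G X X' b B :
    G ⊢ HasLinear X b B -> Permutation X X' -> G ⊢ HasLinear X' b B
| lin_exchange_eq G X X' b b' B :
    G ⊢ EqLTerm X b b' B -> Permutation X X' -> G ⊢ EqLTerm X' b b' B

| ty_refl G A : G ⊢ IsType A -> G ⊢ EqType A A
| ty_sym G A B : G ⊢ EqType A B -> G ⊢ EqType B A
| ty_trans G A B C : G ⊢ EqType A B -> G ⊢ EqType B C -> G ⊢ EqType A C
| lin_refl G A : G ⊢ IsLinear A -> G ⊢ EqLinear A A
| lin_sym G A B : G ⊢ EqLinear A B -> G ⊢ EqLinear B A
| lin_trans G A B C :
    G ⊢ EqLinear A B -> G ⊢ EqLinear B C -> G ⊢ EqLinear A C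
| tm_refl G a A : G ⊢ HasType a A -> G ⊢ EqTerm a a A
| tm_sym G a b A : G ⊢ EqTerm a b A -> G ⊢ EqTerm b a A
| tm_trans G a b c A :
    G ⊢ EqTerm a b A -> G ⊢ EqTerm b c A -> G ⊢ EqTerm a c A
| ltm_refl G X a A : G ⊢ HasLinear X a A -> G ⊢ EqLTerm X a a A
| ltm_sym G X a b A : G ⊢ EqLTerm X a b A -> G ⊢ EqLTerm X b a A
| ltm_trans G X a b c A :
    G ⊢ EqLTerm X a b A -> G ⊢ EqLTerm X b c A -> G ⊢ EqLTerm X a c A
| tm_conv G a A A' :
    G ⊢ HasType a A -> G ⊢ EqType A A' -> G ⊢ HasType a A'
| tm_eq_conv G a b A A' :
    G ⊢ EqTerm a b A -> G ⊢ EqType A A' -> G ⊢ EqTerm a b A'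
| ltm_conv G X a A A' :
    G ⊢ HasLinear X a A -> G ⊢ EqLinear A A' -> G ⊢ HasLinear X a A'
| ltm_eq_conv G X a b A A' :
    G ⊢ EqLTerm X a b A -> G ⊢ EqLinear A A' -> G ⊢ EqLTerm X a b A'

| subst_ty_cong G D A a a' C :
    D ++ A :: G ⊢ IsType C -> G ⊢ EqTerm a a' A ->
    tele_map (csub_at a) D ++ G
      ⊢ EqType (csub_at a (length D) C) (csub_at a' (length D) C)
| subst_lin_cong G D A a a' C :
    D ++ A :: G ⊢ IsLinear C -> G ⊢ EqTerm a a' A ->
    tele_map (csub_at a) D ++ G
      ⊢ EqLinear (csub_at a (length D) C) (csub_at a' (length D) C)
| subst_tm_cong G D A a a' t C :
    D ++ A :: G ⊢ HasType t C -> G ⊢ EqTerm a a' A ->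
    tele_map (csub_at a) D ++ G
      ⊢ EqTerm (csub_at a (length D) t) (csub_at a' (length D) t)
               (csub_at a (length D) C)
| subst_ltm_cong G D A a a' X t C :
    D ++ A :: G ⊢ HasLinear X t C -> G ⊢ EqTerm a a' A ->
    tele_map (csub_at a) D ++ G
      ⊢ EqLTerm (lctx_map (csub_at a (length D)) X)
                (csub_at a (length D) t) (csub_at a' (length D) t)
                (csub_at a (length D) C)
| lin_subst_cong G X1 X2 X' y A a a' t t' B :
    G ⊢ EqLTerm (X1 ++ (y, A) :: X2) t t' B ->
    G ⊢ EqLTerm X' a a' A ->
    distinct (X1 ++ X' ++ X2) ->
    G ⊢ EqLTerm (X1 ++ X' ++ X2) (lsub y a t) (lsub y a' t') B

| L_F G A :
    G ⊢ IsType A -> G ⊢ IsLinear (tyL A)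
| L_I G a A :
    G ⊢ HasType a A -> G ⊢ HasLinear [] (tmL a) (tyL A)
| L_E G X X' y t A B :
    G ⊢ IsLinear B -> G ⊢ IsCtx X' ->
    G ⊢ HasLinear X y (tyL A) ->
    A :: G ⊢ HasLinear (lctx_map (@shift O) X') t (shift B) ->
    distinct (X ++ X') ->
    G ⊢ HasLinear (X ++ X') (letL y t) B
| L_C G X s t B :
    G ⊢ HasLinear X (letL (tmL s) t) B ->
    G ⊢ EqLTerm X (letL (tmL s) t) (csub s t) B
| L_U G X X' y a t A B :
    G ⊢ HasLinear ((y, tyL A) :: X) t B ->
    G ⊢ HasLinear X' a (tyL A) ->
    distinct (X ++ X') ->
    G ⊢ EqLTerm (X ++ X')
          (letL a (lsub y (tmL (cvar 0)) (shift t))) (lsub y a t) B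
| L_F_cong G A A' :
    G ⊢ EqType A A' -> G ⊢ EqLinear (tyL A) (tyL A')
| L_I_cong G a a' A :
    G ⊢ EqTerm a a' A -> G ⊢ EqLTerm [] (tmL a) (tmL a') (tyL A)
| L_E_cong G X X' y y' t t' A B :
    G ⊢ IsLinear B -> G ⊢ IsCtx X' ->
    G ⊢ EqLTerm X y y' (tyL A) ->
    A :: G ⊢ EqLTerm (lctx_map (@shift O) X') t t' (shift B) ->
    distinct (X ++ X') ->
    G ⊢ EqLTerm (X ++ X') (letL y t) (letL y' t') B

| M_F G B :
    G ⊢ IsLinear B -> G ⊢ IsType (tyM B)
| M_I G b B :
    G ⊢ HasLinear [] b B -> G ⊢ HasType (sigma b) (tyM B)
| M_E G t B :
    G ⊢ HasType t (tyM B) -> G ⊢ HasLinear [] (sigma_inv t) B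
| M_C1 G b B :
    G ⊢ HasLinear [] b B -> G ⊢ EqLTerm [] (sigma_inv (sigma b)) b B
| M_C2 G t B :
    G ⊢ HasType t (tyM B) -> G ⊢ EqTerm (sigma (sigma_inv t)) t (tyM B)
| M_F_cong G B B' :
    G ⊢ EqLinear B B' -> G ⊢ EqType (tyM B) (tyM B')
| M_I_cong G b b' B :
    G ⊢ EqLTerm [] b b' B -> G ⊢ EqTerm (sigma b) (sigma b') (tyM B)
| M_E_cong G t t' B :
    G ⊢ EqTerm t t' (tyM B) -> G ⊢ EqLTerm [] (sigma_inv t) (sigma_inv t') B

(* An instance of R whose conclusion has variables not declared in its context
   is disregarded. *)
| extra_rule G J ps :
    scoped_judgment G J ->
    R ps (G, J) ->
    (forall G' J', In (G', J') ps -> G' ⊢ J') ->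
    G ⊢ J
where "G ⊢ J" := (derivable _ G J).

(* Main.v *)
Require Import Defs.
From Stdlib Require Import List Permutation Arith Lia.
Import ListNotations.

(** Take epsilon_B to be [let x be beta1 in sigma^{-1}(x)].  By L-U applied to
    the variable [y] itself, followed by L-C, the composite of epsilon_B with
    [let x be y in g_L] equals [let x be y in sigma^{-1}(g)].  Substituting [x_L]
    for [y] then recovers [sigma^{-1}(g)], so the equation for [g] amounts to
    [sigma^{-1}(g) = f[x_L/y]], whose only solution is [sigma(f[x_L/y])].

    Both steps need that [y] does not occur in [g], which holds because
    derivable judgments are well scoped. *)

(** * Substitution calculus *)

Lemma upr_ext (r r' : nat -> nat) :
  (forall n, r n = r' n) -> forall n, upr r n = upr r' n.
Proof. intros H [|n]; simpl; [|rewrite H]; reflexivity. Qed.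

Lemma ren_ext (O : Type) (e : expr O) (r r' : nat -> nat) :
  (forall n, r n = r' n) -> ren r e = ren r' e.
Proof.
  revert r r'; induction e; simpl; intros r r' H; f_equal; auto using upr_ext.
Qed.

Lemma ren_ren (O : Type) (e : expr O) (r r' : nat -> nat) :
  ren r (ren r' e) = ren (fun n => r (r' n)) e.
Proof.
  revert r r'; induction e; simpl; intros r r'; f_equal; auto.
  - rewrite IHe2; apply ren_ext; intros [|n]; reflexivity.
  - rewrite IHe; apply ren_ext; intros [|n]; reflexivity.
Qed.

Lemma ren_upr_shift (O : Type) (r : nat -> nat) (e : expr O) :
  ren (upr r) (shift e) = shift (ren r e).
Proof. unfold shift; rewrite !ren_ren; apply ren_ext; reflexivity. Qed.

Lemma up_ext_scoped (O : Type) (k : nat) (s s' : nat -> expr O) :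
  (forall n, n < k -> s n = s' n) -> forall n, n < S k -> up s n = up s' n.
Proof.
  intros H [|n] Hn; simpl; [reflexivity|].
  f_equal; apply H; lia.
Qed.

(** Agreement is asked only on the variables that scoping allows in [e]. This is what turns a
    scoping fact into the statement that a linear substitution leaves an expression alone. *)
Lemma sub_ext_scoped (O : Type) (e : expr O) :
  forall (k m : nat) (N : list name) (s s' : nat -> expr O)
    (l l' : name -> expr O),
  (forall n, n < k -> s n = s' n) ->
  (forall z, In z N -> l z = l' z) ->
  scoped k m N e -> sub s l e = sub s' l' e.
Proof.
  induction e; simpl; intros k m N s s' l l' Hs Hl He;
    try destruct He; f_equal; eauto.
  - eapply IHe2; eauto using up_ext_scoped.
    intros z Hz; simpl; rewrite Hl by exact Hz; reflexivity.
  - eapply IHe; eauto using up_ext_scoped.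
    intros z Hz; simpl; rewrite Hl by exact Hz; reflexivity.
Qed.

Lemma sub_id (O : Type) (e : expr O) (s : nat -> expr O) (l : name -> expr O) :
  (forall n, s n = cvar n) -> (forall z, l z = lvar z) -> sub s l e = e.
Proof.
  revert s l; induction e; simpl; intros s l Hs Hl; f_equal; auto.
  - apply IHe2; [intros [|m]; simpl; rewrite ?Hs; reflexivity|].
    intros z; rewrite Hl; reflexivity.
  - apply IHe; [intros [|m]; simpl; rewrite ?Hs; reflexivity|].
    intros z; rewrite Hl; reflexivity.
Qed.

(** Stated for any left inverse [s] of [r], so that the induction passes under binders: [up s] is
    again a left inverse of [upr r]. *)
Lemma sub_ren_id (O : Type) (e : expr O) (r : nat -> nat) (s : nat -> expr O)
    (l : name -> expr O) :
  (forall n, s (r n) = cvar n) -> (forall z, l z = lvar z) ->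
  sub s l (ren r e) = e.
Proof.
  revert r s l; induction e; simpl; intros r s l Hs Hl; f_equal; auto.
  - apply IHe2; [intros [|m]; simpl; rewrite ?Hs; reflexivity|].
    intros z; rewrite Hl; reflexivity.
  - apply IHe; [intros [|m]; simpl; rewrite ?Hs; reflexivity|].
    intros z; rewrite Hl; reflexivity.
Qed.

Lemma lsub_var (O : Type) (y : name) (e : expr O) : lsub y (lvar y) e = e.
Proof.
  apply sub_id; [reflexivity|].
  intros z; destruct (Nat.eqb_spec z y); subst; reflexivity.
Qed.

(** [ren (upr S)] renames the variable $x$ of index 0 to a new bound copy $x'$ lying above $x$;
    substituting $x$ for $x'$ undoes this. *)
Lemma csub_cvar0_ren (O : Type) (e : expr O) :
  csub (cvar 0) (ren (upr S) e) = e.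
Proof. apply sub_ren_id; [intros [|n]|]; reflexivity. Qed.

(** With no free linear names in [e], the map [l] may be replaced by [lvar]; [up cvar] agrees with
    [cvar] pointwise, by cases on the index. *)
Lemma sub_up_cvar_scoped (O : Type) (k : nat) (l : name -> expr O) (e : expr O) :
  scoped k 0 [] e -> sub (up cvar) l e = e.
Proof.
  intros He; transitivity (sub cvar lvar e).
  - eapply sub_ext_scoped; [| |exact He].
    + intros [|n] _; reflexivity.
    + intros z [].
  - apply sub_id; reflexivity.
Qed.

(** * Scoping *)

Lemma scoped_mono (O : Type) (e : expr O) :
  forall (k k' m m' : nat) (N N' : list name),
  k <= k' -> m <= m' -> incl N N' -> scoped k m N e -> scoped k' m' N' e.
Proof.
  induction e; simpl; intros k k' m m' N N' Hk Hm HN He; try lia; auto;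
    try destruct He; try split;
    match goal with
    | IH : forall k : nat, _ |- scoped _ _ _ _ =>
        eapply IH; [| | |eassumption]; auto using le_n_S
    end.
Qed.

Lemma upr_scoped (k k' : nat) (r : nat -> nat) :
  (forall n, n < k -> r n < k') -> forall n, n < S k -> upr r n < S k'.
Proof.
  intros H [|n] Hn; simpl; [lia|].
  apply -> Nat.succ_lt_mono; apply H; lia.
Qed.

Lemma scoped_ren (O : Type) (e : expr O) :
  forall (k k' m : nat) (N : list name) (r : nat -> nat),
  (forall n, n < k -> r n < k') -> scoped k m N e -> scoped k' m N (ren r e).
Proof.
  induction e; simpl; intros k k' m N r Hr He; auto;
    try destruct He as [He1 He2]; try split; eauto using upr_scoped.
Qed.

Lemma scoped_shift (O : Type) (k m : nat) (N : list name) (e : expr O) :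
  scoped k m N e -> scoped (S k) m N (shift e).
Proof. apply scoped_ren; intros n Hn; lia. Qed.

Lemma up_scoped (O : Type) (k k' m : nat) (N : list name) (s : nat -> expr O) :
  (forall n, n < k -> scoped k' m N (s n)) ->
  forall n, n < S k -> scoped (S k') m N (up s n).
Proof.
  intros H [|n] Hn; simpl; [lia|].
  apply scoped_shift; apply H; lia.
Qed.

Lemma scoped_sub (O : Type) (e : expr O) :
  forall (k k' m : nat) (N N' : list name) (s : nat -> expr O)
    (l : name -> expr O),
  (forall n, n < k -> scoped k' m N' (s n)) ->
  (forall z, In z N -> scoped k' m N' (l z)) ->
  scoped k m N e -> scoped k' m N' (sub s l e).
Proof.
  induction e; simpl; intros k k' m N N' s l Hs Hl He; auto;
    try destruct He as [He1 He2]; try split; eauto using up_scoped, scoped_shift.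
  (* The case of [labs]: the bound on dangling indices grows, while the substituted expressions are
     not shifted, so their scoping is relaxed by monotonicity. *)
  eapply IHe; [| |exact He].
  - intros n Hn; eapply scoped_mono; [| | |exact (Hs n Hn)];
      auto using incl_refl.
  - intros z Hz; eapply scoped_mono; [| | |exact (Hl z Hz)];
      auto using incl_refl.
Qed.

Lemma scoped_lsub (O : Type) (k : nat) (N N' : list name) (y : name)
    (a e : expr O) :
  scoped k 0 N' a -> (forall z, In z N -> z = y \/ In z N') ->
  scoped k 0 N e -> scoped k 0 N' (lsub y a e).
Proof.
  intros Ha HN; apply scoped_sub; [intros n Hn; exact Hn|].
  intros z Hz; destruct (Nat.eqb_spec z y) as [|Hzy]; [exact Ha|].
  destruct (HN z Hz) as [|Hz']; [contradiction|exact Hz'].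
Qed.

Lemma iter_upr_scoped (n k k' : nat) (r : nat -> nat) :
  (forall i, i < k -> r i < k') ->
  forall i, i < n + k -> Nat.iter n upr r i < n + k'.
Proof.
  intros H; induction n as [|n IH]; simpl; [exact H|].
  exact (upr_scoped _ _ _ IH).
Qed.

Lemma scoped_weaken_at (O : Type) (n k : nat) (N : list name) (e : expr O) :
  scoped (n + k) 0 N e -> scoped (n + S k) 0 N (weaken_at n e).
Proof.
  apply scoped_ren; apply iter_upr_scoped; intros i Hi; lia.
Qed.

Lemma iter_up_scoped (O : Type) (n k k' m : nat) (N : list name)
    (s : nat -> expr O) :
  (forall i, i < k -> scoped k' m N (s i)) ->
  forall i, i < n + k -> scoped (n + k') m N (Nat.iter n (@up O) s i).
Proof.
  intros H; induction n as [|n IH]; simpl; [exact H|].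
  exact (up_scoped _ _ _ _ _ _ IH).
Qed.

(* [N0] may be nonempty: in L-C, the typing of [let x be s_L in t] does not by
   itself show that [s] is free of linear variables. *)
Lemma scoped_csub_at (O : Type) (n k : nat) (N0 N : list name) (a e : expr O) :
  scoped k 0 N0 a -> incl N0 N ->
  scoped (n + S k) 0 N e -> scoped (n + k) 0 N (csub_at a n e).
Proof.
  intros Ha HN; apply scoped_sub.
  - apply iter_up_scoped; intros [|i] Hi; simpl; [|lia].
    eapply scoped_mono; [| | |exact Ha]; auto.
  - intros z Hz; exact Hz.
Qed.

(** * Scoping of contexts and of judgments *)

Lemma scoped_cctx_nth (O : Type) (G : cctx O) (n : nat) (A : expr O) :
  scoped_cctx G -> nth_error G n = Some A ->
  n < length G /\ scoped (length G) 0 [] (ren (fun i => S n + i) A).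
Proof.
  revert n; induction G as [|C G IH]; intros [|n]; simpl; try discriminate.
  - intros [HC _] [= ->]; split; [lia|].
    exact (scoped_shift _ _ _ _ _ HC).
  - intros [_ HG] Hn; destruct (IH n HG Hn) as [Hlt HA]; split; [lia|].
    apply scoped_shift in HA; unfold shift in HA; rewrite ren_ren in HA.
    exact HA.
Qed.

Lemma length_tele_map (O : Type) (F : nat -> expr O -> expr O) (D : cctx O) :
  length (tele_map F D) = length D.
Proof. induction D; simpl; congruence. Qed.

Lemma scoped_cctx_tele_map (O : Type) (F : nat -> expr O -> expr O)
    (G G' D : cctx O) :
  (forall n C, scoped (n + length G) 0 [] C ->
     scoped (n + length G') 0 [] (F n C)) ->
  scoped_cctx G' -> scoped_cctx (D ++ G) -> scoped_cctx (tele_map F D ++ G').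
Proof.
  intros HF HG'; induction D as [|C D IH]; simpl; [auto|].
  rewrite !length_app, length_tele_map; intros [HC HD]; auto.
Qed.

Lemma scoped_cctx_app (O : Type) (D G : cctx O) :
  scoped_cctx (D ++ G) -> scoped_cctx G.
Proof. induction D; simpl; tauto. Qed.

Lemma map_fst_lctx_map (O : Type) (f : expr O -> expr O) (X : lctx O) :
  map fst (lctx_map f X) = map fst X.
Proof. unfold lctx_map; rewrite map_map; reflexivity. Qed.

Lemma scoped_lctx_map (O : Type) (f : expr O -> expr O) (k k' : nat)
    (X : lctx O) :
  (forall e, scoped k 0 [] e -> scoped k' 0 [] (f e)) ->
  scoped_lctx k X -> scoped_lctx k' (lctx_map f X).
Proof.
  intros Hf; induction 1; constructor; simpl; auto.
Qed.

Lemma scoped_lctx_app (O : Type) (k : nat) (X X' : lctx O) :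
  scoped_lctx k (X ++ X') <-> scoped_lctx k X /\ scoped_lctx k X'.
Proof. apply Forall_app. Qed.

Lemma scoped_lctx_cons (O : Type) (k : nat) (y : name) (A : expr O)
    (X : lctx O) :
  scoped_lctx k ((y, A) :: X) <-> scoped k 0 [] A /\ scoped_lctx k X.
Proof. apply Forall_cons_iff. Qed.

Lemma scoped_lctx_permutation (O : Type) (k : nat) (X X' : lctx O) :
  scoped_lctx k X -> Permutation X X' -> scoped_lctx k X'.
Proof. intros HX HP; eapply Permutation_Forall; eassumption. Qed.

Lemma scoped_permutation (O : Type) (k : nat) (X X' : lctx O) (e : expr O) :
  scoped k 0 (map fst X) e -> Permutation X X' -> scoped k 0 (map fst X') e.
Proof.
  intros He HP; eapply scoped_mono; [| | |exact He]; auto.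
  intros z; apply Permutation_in, Permutation_map, HP.
Qed.

(** Weakening and cartesian substitution both act through [body_map] and keep linear names, so all
    forms of judgment are treated here at once. *)
Lemma scoped_body_map (O : Type) (f : expr O -> expr O) (G G' : cctx O)
    (J : body O) :
  (forall N e, scoped (length G) 0 N e -> scoped (length G') 0 N (f e)) ->
  scoped_cctx G' -> scoped_judgment G J -> scoped_judgment G' (body_map f J).
Proof.
  intros Hf HG' [_ HJ]; split; [exact HG'|].
  destruct J; simpl in *; rewrite ?map_fst_lctx_map;
    intuition eauto using scoped_lctx_map.
Qed.

Lemma scoped_judgment_weakening (O : Type) (G D : cctx O) (A : expr O)
    (J : body O) :
  scoped_judgment (D ++ G) J -> scoped (length G) 0 [] A ->
  scoped_judgment (tele_map (@weaken_at O) D ++ A :: G)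
    (body_map (weaken_at (length D)) J).
Proof.
  intros HJ HA; refine (scoped_body_map _ _ _ _ _ _ _ HJ).
  - intros N e; rewrite !length_app, length_tele_map.
    apply scoped_weaken_at.
  - destruct HJ as [HDG _]; refine (scoped_cctx_tele_map _ _ _ _ _ _ _ HDG).
    + intros n C; apply scoped_weaken_at.
    + split; [exact HA|exact (scoped_cctx_app _ _ _ HDG)].
Qed.

Lemma scoped_csub_tele (O : Type) (G D D' : cctx O) (A a e : expr O)
    (N : list name) :
  length D' = length D -> scoped (length G) 0 [] a ->
  scoped (length (D ++ A :: G)) 0 N e ->
  scoped (length (D' ++ G)) 0 N (csub_at a (length D) e).
Proof.
  intros HD Ha; rewrite !length_app, HD.
  apply scoped_csub_at with []; [exact Ha|intros z []].
Qed.

Lemma scoped_judgment_substitution (O : Type) (G D : cctx O) (A a : expr O)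
    (J : body O) :
  scoped_judgment (D ++ A :: G) J -> scoped (length G) 0 [] a ->
  scoped_judgment (tele_map (csub_at a) D ++ G)
    (body_map (csub_at a (length D)) J).
Proof.
  intros HJ Ha; refine (scoped_body_map _ _ _ _ _ _ _ HJ).
  - intros N e; apply scoped_csub_tele; [apply length_tele_map|exact Ha].
  - destruct HJ as [HDG _]; refine (scoped_cctx_tele_map _ _ _ _ _ _ _ HDG).
    + intros n C; apply scoped_csub_at with []; [exact Ha|intros z []].
    + exact (proj2 (scoped_cctx_app _ _ _ HDG)).
Qed.

Lemma scoped_lsub_app (O : Type) (k : nat) (N1 N N2 : list name) (y : name)
    (a t : expr O) :
  scoped k 0 (N1 ++ y :: N2) t -> scoped k 0 N a ->
  scoped k 0 (N1 ++ N ++ N2) (lsub y a t).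
Proof.
  intros Ht Ha; apply scoped_lsub with (N1 ++ y :: N2); [| |exact Ht].
  - eapply scoped_mono; [| | |exact Ha]; auto using incl_appl, incl_appr, incl_refl.
  - intros z; rewrite !in_app_iff; simpl; intuition.
Qed.

(* The formers of [O] need no case of their own: [extra_rule] only admits
   conclusions that are well scoped. *)
Lemma derivable_scoped (O : Type) (R : ruleset O) (G : cctx O) (J : body O) :
  derivable R G J -> scoped_judgment G J.
Proof.
  induction 1;
    (* Weakening and substitution concern an arbitrary [J], so they are settled before scoping is
       unfolded into conjunctions. *)
    try (apply scoped_judgment_weakening; [assumption|apply IHderivable2]);
    try (eapply scoped_judgment_substitution;
         [eassumption|apply (proj1 (proj2 IHderivable2))]);
    unfold scoped_judgment in *; simpl in *;
    rewrite ?map_fst_lctx_map, ?map_app, ?scoped_lctx_app, ?scoped_lctx_cons in *;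
    simpl in *;
    repeat match goal with H : _ /\ _ |- _ => destruct H end;
    repeat match goal with |- _ /\ _ => split end;
    auto using Forall_nil, scoped_lsub_app;
    try solve [eauto using scoped_lctx_permutation, scoped_permutation];
    try solve [apply Forall_nil];
    try match goal with
    | |- scoped_cctx (tele_map (csub_at ?a) ?D ++ ?G) =>
        (* For the substitution congruences, scoping of the substituted telescope is read off from
           the trivial judgment [IsCtx []]. *)
        apply (scoped_judgment_substitution O G D A a (IsCtx []));
        [split; [assumption|constructor]|assumption]
    | |- scoped_lctx _ (lctx_map _ _) =>
        eapply scoped_lctx_map; [|eassumption]
    end;
    try match goal with
    | |- scoped _ _ _ (csub_at _ (length _) _) =>
        eapply scoped_csub_tele; [apply length_tele_map| |]; eassumption
    | |- scoped _ _ (_ ++ _) _ =>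
        eapply scoped_mono; [reflexivity|reflexivity| |eassumption];
        auto using incl_appl, incl_appr, incl_refl
    end.
  - intros e; apply scoped_shift.
  - eapply scoped_cctx_nth; eassumption.
  - eapply scoped_cctx_nth; eassumption.
  - intros e; apply scoped_csub_tele; [apply length_tele_map|assumption].
  - eapply (scoped_csub_at O 0); [eassumption|apply incl_refl|assumption].
  (* The two sides of L-U: first $x_L$ replaces $y$ under the binder, then $a$ replaces it
     outside. *)
  - eapply scoped_lsub; [simpl; lia| |apply scoped_shift; eassumption].
    intros z; simpl; rewrite in_app_iff; intuition.
  - eapply scoped_lsub; [| |eassumption].
    + eapply scoped_mono; [| | |eassumption]; auto using incl_appr, incl_refl.
    + intros z; simpl; rewrite in_app_iff; intuition.
Qed.

(** * The universal property *)

Definition counit {O : Type} (beta : name) : expr O :=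
  letL (lvar beta) (sigma_inv (cvar 0)).

Lemma lsub_counit (O : Type) (beta : name) (a : expr O) :
  lsub beta a (counit beta) = letL a (sigma_inv (cvar 0)).
Proof. unfold lsub, counit; simpl; rewrite Nat.eqb_refl; reflexivity. Qed.

Lemma IsCtx_cons (O : Type) (R : ruleset O) (G : cctx O) (A : expr O) :
  derivable R G (IsCtx []) ->
  derivable R G (IsType A) -> derivable R (A :: G) (IsCtx []).
Proof. exact (@ctx_cext O R G [] A). Qed.

Lemma HasType_cvar0 (O : Type) (R : ruleset O) (G : cctx O) (A : expr O) :
  derivable R G (IsCtx []) ->
  derivable R G (IsType A) -> derivable R (A :: G) (HasType (cvar 0) (shift A)).
Proof.
  intros ctxG HA; exact (var_c (n := 0) (IsCtx_cons _ _ _ _ ctxG HA) eq_refl).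
Qed.

Lemma HasLinear_lvar (O : Type) (R : ruleset O) (G : cctx O)
    (y : name) (B : expr O) :
  derivable R G (IsCtx []) ->
  derivable R G (IsLinear B) -> derivable R G (HasLinear [(y, B)] (lvar y) B).
Proof.
  intros ctxG HB; apply var_l.
  apply (@ctx_lext O R G [] y B); auto.
Qed.

Lemma HasLinear_sigma_inv_cvar0 (O : Type) (R : ruleset O) (G : cctx O) (B : expr O) :
  derivable R G (IsCtx []) ->
  derivable R G (IsLinear B) ->
  derivable R (tyM B :: G) (HasLinear [] (sigma_inv (cvar 0)) (shift B)).
Proof.
  intros ctxG HB; apply M_E; exact (HasType_cvar0 _ _ _ _ ctxG (M_F HB)).
Qed.

(** L-E with $\Xi'$ empty: every [let] in the argument has a body without linear assumptions. *)
Lemma HasLinear_let (O : Type) (R : ruleset O) (G : cctx O) (A B y t : expr O)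
    (X : lctx O) :
  derivable R G (IsCtx []) -> NoDup (map fst X) -> derivable R G (IsLinear B) ->
  derivable R G (HasLinear X y (tyL A)) ->
  derivable R (A :: G) (HasLinear [] t (shift B)) ->
  derivable R G (HasLinear X (letL y t) B).
Proof.
  intros ctxG HX HB Hy Ht; rewrite <- (app_nil_r X).
  eapply L_E with (X' := []); try eassumption.
  rewrite app_nil_r; exact HX.
Qed.

(** The term is $\epsilon_B[a/\beta_1]$; taking $\beta_1$ itself for $a$ types $\epsilon_B$. *)
Lemma HasLinear_unpack (O : Type) (R : ruleset O) (G : cctx O)
    (X : lctx O) (a B : expr O) :
  derivable R G (IsCtx []) ->
  NoDup (map fst X) -> derivable R G (IsLinear B) ->
  derivable R G (HasLinear X a (tyL (tyM B))) ->
  derivable R G (HasLinear X (letL a (sigma_inv (cvar 0))) B).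
Proof.
  intros ctxG HX HB Ha; eapply HasLinear_let; try eassumption.
  exact (HasLinear_sigma_inv_cvar0 _ _ _ _ ctxG HB).
Qed.

Lemma unpack_tmL (O : Type) (R : ruleset O) (G : cctx O) (g B : expr O) :
  derivable R G (IsCtx []) ->
  derivable R G (IsLinear B) -> derivable R G (HasType g (tyM B)) ->
  derivable R G
    (EqLTerm [] (letL (tmL g) (sigma_inv (cvar 0))) (sigma_inv g) B).
Proof.
  (* With the body made explicit, [csub g (sigma_inv (cvar 0))] computes to [sigma_inv g]. *)
  intros ctxG HB Hg; apply (L_C (t := sigma_inv (cvar 0))).
  apply HasLinear_unpack; [exact ctxG|constructor|exact HB|exact (L_I Hg)].
Qed.

Lemma IsLinear_shift (O : Type) (R : ruleset O) (G : cctx O) (A B : expr O) :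
  derivable R G (IsType A) -> derivable R G (IsLinear B) ->
  derivable R (A :: G) (IsLinear (shift B)).
Proof. intros HA HB; exact (weakening (D := []) HB HA). Qed.

Lemma HasLinear_tmL_cvar0 (O : Type) (R : ruleset O) (G : cctx O) (A : expr O) :
  derivable R G (IsCtx []) -> derivable R G (IsType A) ->
  derivable R (A :: G) (HasLinear [] (tmL (cvar 0)) (tyL (shift A))).
Proof. intros ctxG HA; exact (L_I (HasType_cvar0 _ _ _ _ ctxG HA)). Qed.

(** L-C for the variable $x$ itself: $\text{let } x' \text{ be } x_L \text{ in } t[x'/x] \equiv
    t$. *)
Lemma let_tmL_cvar0 (O : Type) (R : ruleset O) (G : cctx O) (A B t : expr O) :
  derivable R G (IsCtx []) -> derivable R G (IsType A) ->
  derivable R G (IsLinear B) ->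
  derivable R (A :: G) (HasLinear [] t (shift B)) ->
  derivable R (A :: G)
    (EqLTerm [] (letL (tmL (cvar 0)) (ren (upr S) t)) t (shift B)).
Proof.
  intros ctxG HA HB Ht.
  rewrite <- (csub_cvar0_ren _ t) at 2.
  apply L_C.
  apply HasLinear_let with (A := shift A).
  - apply IsCtx_cons; assumption.
  - constructor.
  - apply IsLinear_shift; assumption.
  - apply HasLinear_tmL_cvar0; assumption.
  (* The fresh variable is inserted below the one about to be bound, so the head of the context
     becomes $x'$. *)
  - pose proof (weakening (D := [A]) Ht HA) as Ht'; simpl in Ht'.
    unfold weaken_at in Ht'; simpl in Ht'.
    rewrite ren_upr_shift in Ht'; exact Ht'.
Qed.

(** As $t$ has no linear variables, substituting $x_L$ for $y$ changes only the term being unpacked,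
    and the shift acts on $t$ beneath its bound variable. *)
Lemma lsub_let_tmL_scoped (O : Type) (k : nat) (y : name) (t : expr O) :
  scoped (S k) 0 [] t ->
  lsub y (tmL (cvar 0)) (shift (letL (lvar y) t)) =
  letL (tmL (cvar 0)) (ren (upr S) t).
Proof.
  intros Ht; unfold lsub; simpl; rewrite Nat.eqb_refl.
  f_equal; apply sub_up_cvar_scoped with (S (S k)).
  eapply scoped_ren; [|exact Ht]; apply upr_scoped; intros n Hn; lia.
Qed.

(** L-U with $a$ taken to be $y$, since $t[y/y]$ is $t$. *)
Lemma let_eta (O : Type) (R : ruleset O) (G : cctx O) (A B t : expr O)
    (y : name) :
  derivable R G (IsCtx []) -> derivable R G (IsType A) ->
  derivable R G (HasLinear [(y, tyL A)] t B) ->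
  derivable R G
    (EqLTerm [(y, tyL A)]
       (letL (lvar y) (lsub y (tmL (cvar 0)) (shift t))) t B).
Proof.
  intros ctxG HA Ht.
  rewrite <- (lsub_var _ y t) at 2.
  eapply (L_U (X := []) (X' := [(y, tyL A)])); [exact Ht| |].
  - apply HasLinear_lvar; [exact ctxG|exact (L_F HA)].
  - repeat constructor; intros [].
Qed.

Lemma counit_after_let (O : Type) (R : ruleset O) (G : cctx O)
    (A B g : expr O) (y beta : name) :
  derivable R G (IsCtx []) -> derivable R G (IsType A) ->
  derivable R G (IsLinear B) ->
  derivable R (A :: G) (HasType g (shift (tyM B))) ->
  derivable R G
    (EqLTerm [(y, tyL A)] (lsub beta (letL (lvar y) (tmL g)) (counit beta))
       (letL (lvar y) (sigma_inv g)) B).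
Proof.
  intros ctxG HA HB Hg; rewrite lsub_counit.
  assert (Hy := HasLinear_lvar _ _ _ y _ ctxG (L_F HA)).
  assert (HBA := IsLinear_shift _ _ _ _ _ HA HB).
  assert (ctxAG := IsCtx_cons _ _ _ _ ctxG HA).
  assert (HyND : NoDup (map fst [(y, tyL A)])) by (repeat constructor; intros []).
  assert (Hlet : derivable R G
      (HasLinear [(y, tyL A)] (letL (lvar y) (tmL g)) (tyL (tyM B)))).
  { eapply HasLinear_let; eauto using L_F, M_F.
    exact (L_I Hg). }
  eapply ltm_trans.
  (* Expanding the whole composite around $y$ plays the part of a commuting conversion: both sides
     become $\text{let } x \text{ be } y$ in some body, and the bodies are compared. *)
  - apply ltm_sym, let_eta; [exact ctxG|exact HA|].
    apply HasLinear_unpack; assumption.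
  - eapply (L_E_cong (X := [(y, tyL A)]) (X' := [])); try eassumption.
    { exact (ltm_refl Hy). }
    set (r := lsub _ _ _).
    assert (Hr : r = letL (letL (tmL (cvar 0)) (ren (upr S) (tmL g)))
                       (sigma_inv (cvar 0))).
    (* Scoping of the cartesian term $g$ shows that $y$ does not occur in it. *)
    { destruct (derivable_scoped _ _ _ _ Hg) as [_ [Hgs _]].
      rewrite <- (lsub_let_tmL_scoped _ (length G) y (tmL g) Hgs).
      reflexivity. }
    rewrite Hr; apply ltm_trans with (letL (tmL g) (sigma_inv (cvar 0))).
    (* The inner [let] contracts to $g_L$ by L-C; a second use of L-C then removes the outer one. *)
    + eapply (L_E_cong (X := []) (X' := [])); try eassumption.
      * apply (let_tmL_cvar0 _ _ _ A (tyL (tyM B))); eauto using L_F, M_F.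
        exact (L_I Hg).
      * exact (ltm_refl (HasLinear_sigma_inv_cvar0 _ _ _ _ ctxAG HBA)).
      * constructor.
    + exact (unpack_tmL _ _ _ _ _ ctxAG HBA Hg).
Qed.

(** Substituting $x_L$ for $y$ in the weakened equation turns its left side into $\text{let } x'
    \text{ be } x_L \text{ in } t[x'/x]$, which is $t$ by L-C. *)
Lemma let_inj (O : Type) (R : ruleset O) (G : cctx O) (A B t f : expr O)
    (y : name) :
  derivable R G (IsCtx []) -> derivable R G (IsType A) ->
  derivable R G (IsLinear B) ->
  derivable R (A :: G) (HasLinear [] t (shift B)) ->
  derivable R G (EqLTerm [(y, tyL A)] (letL (lvar y) t) f B) ->
  derivable R (A :: G)
    (EqLTerm [] t (lsub y (tmL (cvar 0)) (shift f)) (shift B)).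
Proof.
  intros ctxG HA HB Ht Heq.
  pose proof (weakening (D := []) Heq HA) as Heq'.
  pose proof (lin_subst_cong (X1 := []) (X2 := []) (X' := []) Heq'
    (ltm_refl (HasLinear_tmL_cvar0 _ _ _ _ ctxG HA)) (NoDup_nil _)) as Hsub.
  change (weaken_at (length (@nil (expr O)))) with (@shift O) in Hsub.
  destruct (derivable_scoped _ _ _ _ Ht) as [_ [_ [Hts _]]].
  rewrite (lsub_let_tmL_scoped _ _ _ _ Hts) in Hsub.
  eapply ltm_trans; [|exact Hsub].
  apply ltm_sym, let_tmL_cvar0; assumption.
Qed.

Theorem mainTheorem1 :
  forall (O : Type) (R : ruleset O) (G : cctx O) (A B : expr O),
    derivable R G (IsCtx []) ->
    derivable R G (IsType A) ->
    derivable R G (IsLinear B) ->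
    forall beta1 : name,
    exists eps : expr O,
      derivable R G (HasLinear [(beta1, tyL (tyM B))] eps B) /\
      forall (y : name) (f : expr O),
        derivable R G (HasLinear [(y, tyL A)] f B) ->
        exists g : expr O,
          (derivable R (A :: G) (HasType g (shift (tyM B))) /\
           derivable R G
             (EqLTerm [(y, tyL A)]
                (lsub beta1 (letL (lvar y) (tmL g)) eps) f B)) /\
          forall g' : expr O,
            derivable R (A :: G) (HasType g' (shift (tyM B))) ->
            derivable R G
              (EqLTerm [(y, tyL A)]
                 (lsub beta1 (letL (lvar y) (tmL g')) eps) f B) ->
            derivable R (A :: G) (EqTerm g g' (shift (tyM B))).
Proof.
  intros O R G A B ctxG HA HB beta1; exists (counit beta1); split.
  { apply HasLinear_unpack; [exact ctxG| |exact HB|].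
    - repeat constructor; intros [].
    - apply HasLinear_lvar; [exact ctxG|exact (L_F (M_F HB))]. }
  intros y f Hf; set (b := lsub y (tmL (cvar 0)) (shift f)).
  assert (Hb : derivable R (A :: G) (HasLinear [] b (shift B))).
  { exact (lin_substitution (X1 := []) (X2 := []) (X' := [])
      (weakening (D := []) Hf HA) (HasLinear_tmL_cvar0 _ _ _ _ ctxG HA)
      (NoDup_nil _)). }
  assert (Hg : derivable R (A :: G) (HasType (sigma b) (shift (tyM B))))
    by exact (M_I Hb).
  exists (sigma b); split; [split; [exact Hg|]|].
  (* Existence: the composite is $\text{let } x \text{ be } y \text{ in } \sigma^{-1}(\sigma(b))$;
     M-C$_1$ reduces the body to $b = f[x_L/y]$, and L-U returns $f$. *)
  - eapply ltm_trans; [apply counit_after_let; assumption|].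
    eapply ltm_trans; [|exact (let_eta _ _ _ _ _ _ _ ctxG HA Hf)].
    eapply (L_E_cong (X := [(y, tyL A)]) (X' := [])); try eassumption.
    + apply ltm_refl, HasLinear_lvar; [exact ctxG|exact (L_F HA)].
    + exact (M_C1 Hb).
    + repeat constructor; intros [].
  - intros g' Hg' Heq.
    (* Uniqueness: the equation for $g'$ determines $\sigma^{-1}(g')$; applying $\sigma$ and M-C$_2$
       then determines $g'$. *)
    assert (Hinv : derivable R (A :: G) (EqLTerm [] (sigma_inv g') b (shift B))).
    { apply let_inj with (A := A); [assumption..|exact (M_E Hg')|].
      eapply ltm_trans; [|exact Heq].
      apply ltm_sym, counit_after_let; assumption. }
    eapply tm_trans; [|exact (M_C2 Hg')].
    exact (tm_sym (M_I_cong Hinv)).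
Qed.
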